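(* Let $k$ be a field, $V$ a $k$-vector space, $\mathcal H=T(V)$ and $\mathcal H^+=\bigoplus_{n\ge 1}V^{\otimes n}$, endowed with the shuffle product $\sqcup\!\sqcup$, the operations $\vee$ and $\succ$ derived from the shuffle quadri-algebra structure, the concatenation product and the deconcatenation coproduct $\Delta(u)=\sum_{u=u^1u^2}u^1\otimes u^2$. Then for any $u\in\mathcal H$ and $v,w\in\mathcal H^+$: $$u\sqcup\!\sqcup(vw)=\sum_{u=u^1u^2}(u^1\vee v)(u^2\sqcup\!\sqcup w)=\sum_{u=u^1u^2}(u^1\sqcup\!\sqcup v)(u^2\succ w).$$
   Context: $\mathcal H=T(V)=\bigoplus_{n\ge0}V^{\otimes n}$, with empty word $\mathbf 1$ spanning $V^{\otimes 0}=k$. Words (pure tensors) are written $u=u_1\cdots u_p$ with $u_i\in V$. Juxtaposition $uv=m(u\otimes v)$ is concatenation. The deconcatenation coproduct is $\Delta(u)=\sum_{u=u^1u^2}u^1\otimes u^2$; for a word $u$ of length $p$ the sum runs over all $p+1$ ways of cutting $u$ into a prefix $u^1$ and a suffix $u^2$ (each possibly equal to $\mathbf 1$), and the notation $\sum_{u=u^1u^2}$ is extended linearly to all $u\in\mathcal H$. Let $\mathrm{Sh}(p,q)$ be the set of permutations $\sigma\in S_{p+q}$ with $\sigma(1)<\cdots<\sigma(p)$ and $\sigma(p+1)<\cdots<\sigma(p+q)$. For $u=u_1\cdots u_p$ and $v=u_{p+1}\cdots u_{p+q}$, the shuffle product is $u\sqcup\!\sqcup v=\sum_{\sigma\in\mathrm{Sh}(p,q)}u_{\sigma^{-1}(1)}\cdots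 u_{\sigma^{-1}(p+q)}$, extended bilinearly; $\mathbf 1$ is its unit. Quadri-algebra operations. For $p,q\ge1$, $u=u_1\cdots u_p$ and $v=u_{p+1}\cdots u_{p+q}$, each of the four bilinear operations is given by $\sum_\sigma u_{\sigma^{-1}(1)}\cdots u_{\sigma^{-1}(p+q)}$, the sum being over the $\sigma\in\mathrm{Sh}(p,q)$ such that: - for $u\searrow v$: $\sigma^{-1}(1)=p+1$ and $\sigma^{-1}(p+q)=p+q$ (first letter and last letter both come from $v$); - for $u\nearrow v$: $\sigma^{-1}(1)=p+1$ and $\sigma^{-1}(p+q)=p$ (first letter from $v$, last letter from $u$); - for $u\nwarrow v$: $\sigma^{-1}(1)=1$ and $\sigma^{-1}(p+q)=p$ (first and last letters from $u$); - for $u\swarrow v$: $\sigma^{-1}(1)=1$ and $\sigma^{-1}(p+q)=p+q$ (first letter from $u$, last letter from $v$). An empty sum is $0$. For $a\in\mathcal H^+$ one sets $\mathbf 1\searrow a=a$, $\mathbf 1\nearrow a=\mathbf 1\nwarrow a=\mathbf 1\swarrow a=0$, and $a\nwarrow\mathbf 1=a$, $a\nearrow\mathbf 1=a\searrow\mathbf 1=a\swarrow\mathbf 1=0$. In particular all operations are defined as linear maps $\mathcal H\otimes\mathcal H^+\to\mathcal H^+$. Derived operations used here: $x\succ y=x\nearrow y+x\searrow y$ and $x\vee y=x\searrow y+x\swarrow y$. *)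

(* Defs.v *)
From HB Require Import structures.
From mathcomp Require Import all_boot fingroup perm all_algebra.
From mathcomp Require Import finmap.
From mathcomp Require Import boolp.
From mathcomp Require Import monalg.

Set Implicit Arguments.
Unset Strict Implicit.
Unset Printing Implicit Defensive.

Import GRing.Theory.
Local Open Scope ring_scope.
Local Open Scope quotient_scope.

Section Span.
Variables (k : fieldType) (M : lmodType k).

Definition lspan (P : M -> Prop) (x : M) : Prop :=
  exists2 s : seq (k * M), (forall p, p \in s -> P p.2)
    & x = \sum_(p <- s) p.1 *: p.2.

Lemma lspan0 P : lspan P 0.
Proof. by exists [::] => //; rewrite big_nil. Qed.

Lemma lspanP P a x y : lspan P x -> lspan P y -> lspan P (a *: x + y).
Proof.
move=> [s sP ->] [t tP ->]; exists ([seq (a * p.1, p.2) | p <- s] ++ t).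
  by move=> p; rewrite mem_cat => /orP[/mapP[q /sP Pq ->]|/tP].
rewrite big_cat big_map scaler_sumr; congr (_ + _).
by apply: eq_bigr => p _; rewrite scalerA.
Qed.

End Span.

(* The k-module generated by S, subject to the relations r = 0 for r in P:
   the quotient of the free module on S by the span of P. *)
Section Presented.
Variables (k : fieldType) (S : choiceType) (P : {malg k[S]} -> Prop).

Definition relb : {pred {malg k[S]}} := fun x => `[< lspan P x >].

Lemma relb_zmod : zmod_closed relb.
Proof.
split=> [|x y]; rewrite ?unfold_in; first by apply/asboolP; exact: lspan0.
move=> /asboolP Px /asboolP Py; apply/asboolP.
by rewrite addrC -scaleN1r; exact: lspanP.
Qed.

HB.instance Definition _ := GRing.isZmodClosed.Build _ relb relb_zmod.

Definition presented : Type := {ideal_quot relb}.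
HB.instance Definition _ := GRing.Zmodule.on presented.

Local Notation pi := (\pi_({ideal_quot relb}) : {malg k[S]} -> presented).

Definition pres_repr (x : presented) : {malg k[S]} :=
  generic_quotient.repr (x : {ideal_quot relb}).

Definition pres_scale (a : k) (x : presented) : presented :=
  pi (a *: pres_repr x).

Lemma pres_reprK x : pi (pres_repr x) = x.
Proof. exact: reprK. Qed.

Lemma pres_eqP x y : reflect (pi x = pi y) (relb (x - y)).
Proof.
by apply: (iffP idP) => [|/eqP]; [move=> h; apply/eqP|];
  rewrite -[_ == _]/(_ == _ :> {ideal_quot relb}) -Quotient.idealrBE.
Qed.

Lemma pres_piD : {morph pi : x y / x + y}.
Proof. exact: raddfD. Qed.

Lemma pres_pi_scale a x : pi (a *: x) = pres_scale a (pi x).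
Proof.
apply/pres_eqP; rewrite -scalerBr; apply/asboolP; rewrite -[_ *: _]addr0.
apply: lspanP; last exact: lspan0.
by apply/asboolP; apply/pres_eqP; rewrite pres_reprK.
Qed.

Fact pres_scaleA a b x : pres_scale a (pres_scale b x) = pres_scale (a * b) x.
Proof. by rewrite -[x]pres_reprK -!pres_pi_scale scalerA. Qed.

Fact pres_scale1 : left_id 1 pres_scale.
Proof. by move=> x; rewrite -[x]pres_reprK -pres_pi_scale scale1r. Qed.

Fact pres_scaleDr : right_distributive pres_scale +%R.
Proof.
move=> a x y; rewrite -[x]pres_reprK -[y]pres_reprK.
by rewrite -pres_piD -!pres_pi_scale scalerDr pres_piD.
Qed.

Fact pres_scaleDl x : {morph pres_scale^~ x : a b / a + b}.
Proof.
by move=> a b /=; rewrite -[x]pres_reprK -!pres_pi_scale scalerDl pres_piD.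
Qed.

HB.instance Definition _ := GRing.Zmodule_isLmodule.Build k presented
  pres_scaleA pres_scale1 pres_scaleDr pres_scaleDl.

Lemma pres_piZ a x : pi (a *: x) = a *: pi x.
Proof. exact: pres_pi_scale. Qed.

Definition pres_gen (s : S) : presented := pi << s >>.

Lemma pres_gen_rel a s t u : P (<< s >> - (a *: << t >> + << u >>)) ->
  pres_gen s = a *: pres_gen t + pres_gen u.
Proof.
move=> Pr; rewrite /pres_gen -pres_piZ -pres_piD; apply/pres_eqP/asboolP.
exists [:: (1, << s >> - (a *: << t >> + << u >>))].
  by move=> p; rewrite inE => /eqP ->.
by rewrite big_seq1 scale1r.
Qed.

Section Lift.
Variables (W : lmodType k) (f : S -> W).

Definition free_ext (x : {malg k[S]}) : W := \sum_(s <- msupp x) x@_s *: f s.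

(* The linear extension of f.  It evaluates the linear extension of f to the
   free module at a representative, hence is meaningful only when this
   extension kills the relations (pres_liftP, pres_lift_gen). *)
Definition pres_lift (x : presented) : W := free_ext (pres_repr x).

Lemma free_extEw (d : {fset S}) x : (msupp x `<=` d)%fset ->
  free_ext x = \sum_(s <- d) x@_s *: f s.
Proof.
move=> le; rewrite /free_ext (big_fset_incl _ le) // => s _ /mcoeff_outdom ->.
by rewrite scale0r.
Qed.

Lemma free_extP a x y : free_ext (a *: x + y) = a *: free_ext x + free_ext y.
Proof.
pose d := (msupp x `|` msupp y)%fset.
rewrite (@free_extEw d x) ?fsubsetUl // (@free_extEw d y) ?fsubsetUr //.
rewrite (@free_extEw d); last first.
  apply: fsubset_trans (msuppD_le _ _) _.
  by apply: fsetUSS => //; exact: msuppZ_le.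
rewrite scaler_sumr -big_split; apply: eq_bigr => s _ /=.
by rewrite mcoeffD mcoeffZ scalerDl scalerA.
Qed.

HB.instance Definition _ := GRing.isLinear.Build k {malg k[S]} W *:%R free_ext
  (fun a x y => free_extP a x y).

Lemma free_ext_gen s : free_ext << s >> = f s.
Proof. by rewrite /free_ext msuppU oner_eq0 big_seq_fset1 mcoeffUU scale1r. Qed.

Hypothesis fP : forall r, P r -> free_ext r = 0.

Lemma pres_lift_pi x : pres_lift (pi x) = free_ext x.
Proof.
apply/eqP; rewrite -subr_eq0 -linearB; apply/eqP.
have /asboolP [s sP ->] : relb (pres_repr (pi x) - x).
  by apply/pres_eqP; rewrite pres_reprK.
rewrite linear_sum big_seq big1 // => p /sP /fP E.
by rewrite linearZ /= E scaler0.
Qed.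

Lemma pres_lift_gen s : pres_lift (pres_gen s) = f s.
Proof. by rewrite pres_lift_pi free_ext_gen. Qed.

Lemma pres_liftP : linear pres_lift.
Proof.
move=> a x y; rewrite -[x]pres_reprK -[y]pres_reprK.
by rewrite -[a *: _]pres_piZ -pres_piD !pres_lift_pi free_extP.
Qed.

End Lift.
End Presented.

Section TensorProduct.
Variables (k : fieldType) (U V : lmodType k).

Variant tensor_rel : {malg k[(U * V)%type]} -> Prop :=
| TensorRelL a x y v :
    tensor_rel (<< (a *: x + y, v) >> - (a *: << (x, v) >> + << (y, v) >>))
| TensorRelR a u x y :
    tensor_rel (<< (u, a *: x + y) >> - (a *: << (u, x) >> + << (u, y) >>)).

Definition tensor : Type := presented tensor_rel.
HB.instance Definition _ := GRing.Lmodule.on tensor.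

Definition tens (u : U) (v : V) : tensor := pres_gen tensor_rel (u, v).

Definition bilinear_fun (W : lmodType k) (B : U -> V -> W) : Prop :=
  (forall v, linear (B^~ v)) /\ (forall u, linear (B u)).

Definition tensor_lift (W : lmodType k) (B : U -> V -> W) (t : tensor) : W :=
  pres_lift (fun p => B p.1 p.2) t.

Section Lift.
Variables (W : lmodType k) (B : U -> V -> W).
Hypothesis Bbil : bilinear_fun B.

Lemma tensor_relP r : tensor_rel r -> free_ext (fun p => B p.1 p.2) r = 0.
Proof.
by case: Bbil => Bl Br; case=> [a x y v|a u x y];
  rewrite linearB linearP /= !free_ext_gen /= ?Bl ?Br subrr.
Qed.

Lemma tensor_lift_tens u v : tensor_lift B (tens u v) = B u v.
Proof. exact: (pres_lift_gen tensor_relP (u, v)). Qed.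

Lemma tensor_liftP : linear (tensor_lift B).
Proof. exact: (pres_liftP tensor_relP). Qed.

End Lift.

Lemma tensDl a x y v : tens (a *: x + y) v = a *: tens x v + tens y v.
Proof. by apply: pres_gen_rel; exact: TensorRelL. Qed.

Lemma tensDr a u x y : tens u (a *: x + y) = a *: tens u x + tens u y.
Proof. by apply: pres_gen_rel; exact: TensorRelR. Qed.

End TensorProduct.

Section TensorAlgebra.
Variables (k : fieldType) (V : lmodType k).

(* T(V) is presented by the words in V (of all lengths, including the empty
   one), subject to linearity in each letter. *)
Variant word_rel : {malg k[seq V]} -> Prop :=
| WordRel a x y (w1 w2 : seq V) :
    word_rel (<< w1 ++ (a *: x + y) :: w2 >> -
              (a *: << w1 ++ x :: w2 >> + << w1 ++ y :: w2 >>)).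

Definition tensalg : Type := presented word_rel.
HB.instance Definition _ := GRing.Lmodule.on tensalg.

Definition word (w : seq V) : tensalg := pres_gen word_rel w.

Definition tensalg_plus : tensalg -> Prop :=
  lspan (fun x => exists2 w : seq V, (0 < size w)%N & x = word w).

Definition multilinear_fun (W : lmodType k) (f : seq V -> W) : Prop :=
  forall a x y w1 w2,
    f (w1 ++ (a *: x + y) :: w2) = a *: f (w1 ++ x :: w2) + f (w1 ++ y :: w2).

(* As for pres_lift, meaningful only for f linear in each letter, see
   word_lift_word and word_lift2_word. *)
Definition word_lift (W : lmodType k) (f : seq V -> W) (x : tensalg) : W :=
  pres_lift f x.

Definition word_lift2 (W : lmodType k) (f : seq V -> seq V -> W)
    (x y : tensalg) : W :=
  word_lift (fun u => word_lift (fun v => f u v) y) x.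

Lemma word_multilinear : multilinear_fun word.
Proof. by move=> a x y w1 w2; apply: pres_gen_rel; exact: WordRel. Qed.

Lemma tensalg_span (x : tensalg) :
  lspan (fun y => exists w : seq V, y = word w) x.
Proof.
rewrite -[x]pres_reprK [pres_repr x]monalgE /=.
exists [seq ((pres_repr x)@_s, word s) | s <- msupp (pres_repr x)].
  by move=> p /mapP[s _ ->]; exists s.
rewrite big_map (raddf_sum (\pi_({ideal_quot (relb word_rel)}))).
apply: eq_bigr => s _ /=; rewrite -pres_piZ; congr (\pi _).
by apply/malgP => t; rewrite mcoeffZ !mcoeffU mulrnAr mulr1.
Qed.

Section Lift.
Variables (W : lmodType k) (f : seq V -> W).
Hypothesis fmul : multilinear_fun f.

Lemma word_relP r : word_rel r -> free_ext f r = 0.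
Proof.
by case=> a x y w1 w2; rewrite linearB linearP /= !free_ext_gen fmul subrr.
Qed.

Lemma word_lift_word w : word_lift f (word w) = f w.
Proof. exact: (pres_lift_gen word_relP w). Qed.

Lemma word_liftP : linear (word_lift f).
Proof. exact: (pres_liftP word_relP). Qed.

End Lift.

Section Lift2.
Variables (W : lmodType k) (f : seq V -> seq V -> W).
Hypothesis fmull : forall v, multilinear_fun (f^~ v).
Hypothesis fmulr : forall u, multilinear_fun (f u).

Lemma word_lift2_aux y : multilinear_fun (fun u => word_lift (fun v => f u v) y).
Proof.
move=> a x z w1 w2; rewrite /word_lift /pres_lift /free_ext scaler_sumr.
rewrite -big_split; apply: eq_bigr => s _ /=.
by rewrite (fmull s) scalerDr !scalerA [_ * a]mulrC.
Qed.

Lemma word_lift2_word u v : word_lift2 f (word u) (word v) = f u v.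
Proof.
rewrite /word_lift2 word_lift_word; last exact: word_lift2_aux.
exact: word_lift_word.
Qed.

Lemma word_lift2_bilinear : bilinear_fun (word_lift2 f).
Proof.
split=> [y|x a y z]; first exact: word_liftP (word_lift2_aux y).
rewrite /word_lift2 {1 3 5}/word_lift /pres_lift /free_ext scaler_sumr.
rewrite -big_split; apply: eq_bigr => s _ /=.
by rewrite (word_liftP (fmulr s)) scalerDr !scalerA [_ * a]mulrC.
Qed.

End Lift2.

Definition conc : tensalg -> tensalg -> tensalg :=
  word_lift2 (fun u v => word (u ++ v)).

Definition deconc_word (u : seq V) : tensor tensalg tensalg :=
  \sum_(i < (size u).+1) tens (word (take i u)) (word (drop i u)).

Definition deconc : tensalg -> tensor tensalg tensalg := word_lift deconc_word.

(* The sum of B u^1 u^2 over u = u^1 u^2, meaningful for bilinear B only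
   (deconc_sumE). *)
Definition deconc_sum (W : lmodType k) (B : tensalg -> tensalg -> W)
    (u : tensalg) : W :=
  tensor_lift B (deconc u).

(* Letters and positions are numbered from 0; w is meant to have length n. *)
Definition perm_word n (s : 'S_n) (w : seq V) : seq V :=
  [seq nth 0 w ((s^-1)%g i) | i <- enum 'I_n].

Definition is_shuffle p q (s : 'S_(p + q)) : bool :=
  [forall i : 'I_p, forall j : 'I_p,
     (i < j)%N ==> (s (lshift q i) < s (lshift q j))%N] &&
  [forall i : 'I_q, forall j : 'I_q,
     (i < j)%N ==> (s (rshift p i) < s (rshift p j))%N].

Definition inv_at n (s : 'S_n) (i j : nat) : bool :=
  [exists x : 'I_n, (x == i :> nat) && ((s^-1)%g x == j :> nat)].

Definition sh_sum (C : forall p q, pred 'S_(p + q)) (u v : seq V) : tensalg :=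
  \sum_(s : 'S_(size u + size v) | is_shuffle s && C (size u) (size v) s)
     word (perm_word s (u ++ v)).

Definition sh_word : seq V -> seq V -> tensalg :=
  sh_sum (fun p q s => true).

(* The letters of u are numbered 0, ..., p - 1 and those of v are numbered
   p, ..., p + q - 1.  On a pair of empty words, where the four operations
   are not defined, they are given the value 0. *)
Definition se_word (u v : seq V) : tensalg :=
  match u, v with
  | [::], [::] => 0
  | [::], _ => word v
  | _, [::] => 0
  | _, _ => sh_sum (fun p q s => inv_at s 0 p && inv_at s (p + q).-1 (p + q).-1) u v
  end.

Definition ne_word (u v : seq V) : tensalg :=
  match u, v with
  | [::], _ | _, [::] => 0
  | _, _ => sh_sum (fun p q s => inv_at s 0 p && inv_at s (p + q).-1 p.-1) u v
  end.

Definition nw_word (u v : seq V) : tensalg :=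
  match u, v with
  | [::], _ => 0
  | _, [::] => word u
  | _, _ => sh_sum (fun p q s => inv_at s 0 0 && inv_at s (p + q).-1 p.-1) u v
  end.

Definition sw_word (u v : seq V) : tensalg :=
  match u, v with
  | [::], _ | _, [::] => 0
  | _, _ => sh_sum (fun p q s => inv_at s 0 0 && inv_at s (p + q).-1 (p + q).-1) u v
  end.

Definition shuffle : tensalg -> tensalg -> tensalg := word_lift2 sh_word.
Definition searrow : tensalg -> tensalg -> tensalg := word_lift2 se_word.
Definition nearrow : tensalg -> tensalg -> tensalg := word_lift2 ne_word.
Definition nwarrow : tensalg -> tensalg -> tensalg := word_lift2 nw_word.
Definition swarrow : tensalg -> tensalg -> tensalg := word_lift2 sw_word.

Definition qsucc (x y : tensalg) : tensalg := nearrow x y + searrow x y.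
Definition qvee (x y : tensalg) : tensalg := searrow x y + swarrow x y.

Lemma conc_mull v : multilinear_fun (fun u => word (u ++ v)).
Proof. by move=> a x y w1 w2 /=; rewrite -!catA /= word_multilinear. Qed.

Lemma conc_mulr u : multilinear_fun (fun v => word (u ++ v)).
Proof. by move=> a x y w1 w2; rewrite !catA word_multilinear. Qed.

Lemma concE u v : conc (word u) (word v) = word (u ++ v).
Proof. exact: (word_lift2_word conc_mull conc_mulr). Qed.

Lemma deconc_multilinear : multilinear_fun deconc_word.
Proof.
move=> a x y w1 w2; rewrite /deconc_word !size_cat /= scaler_sumr -big_split.
apply: eq_bigr => i _ /=; rewrite !take_cat !drop_cat.
case: ltnP => [lt_i|le_i]; first by rewrite word_multilinear tensDr.
case: (_ - _)%N => [|j] /=; first by rewrite (word_multilinear a x y [::]) tensDr.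
by rewrite word_multilinear tensDl.
Qed.

Lemma deconcE u : deconc (word u) = deconc_word u.
Proof. exact: (word_lift_word deconc_multilinear). Qed.

Lemma deconc_sumE (W : lmodType k) (B : tensalg -> tensalg -> W) u :
  bilinear_fun B ->
  deconc_sum B (word u) =
    \sum_(i < (size u).+1) B (word (take i u)) (word (drop i u)).
Proof.
move=> Bbil; rewrite /deconc_sum deconcE /deconc_word.
pose L := GRing.isLinear.Build _ _ _ _ _ (tensor_liftP Bbil).
pose F : {linear _ -> _} := HB.pack (tensor_lift B) L.
rewrite -[tensor_lift B]/(F : _ -> _) linear_sum; apply: eq_bigr => i _.
exact: tensor_lift_tens.
Qed.

Lemma perm_word_split n (s : 'S_n) (w1 w2 : seq V) :
  n = (size w1 + (size w2).+1)%N ->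
  exists t1 t2, forall z, perm_word s (w1 ++ z :: w2) = t1 ++ z :: t2.
Proof.
move=> En; have lt_j : (size w1 < n)%N by rewrite En -addSnnS leq_addr.
pose i := s (Ordinal lt_j).
have: i \in enum 'I_n by rewrite mem_enum.
have := enum_uniq 'I_n; rewrite /perm_word.
move=> /[swap] /path.splitPr[l1 l2]; rewrite cat_uniq /= => /and4P[_ Nl1 Nl2 _].
have Ni j (l : seq 'I_n) : i \notin l -> j \in l ->
    ((s^-1)%g j == size w1 :> nat) = false.
  move=> il jl; apply: contraNF il => /eqP E; suff -> : i = j by [].
  by apply: (@perm_inj _ (s^-1)%g); rewrite permK; apply: val_inj; rewrite /= E.
have nth0 z j : (j == size w1) = false ->
    nth 0 (w1 ++ z :: w2) j = nth 0 (w1 ++ 0 :: w2) j.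
  move=> Nj; rewrite !nth_cat; case: ltnP => // le_j.
  case E: (j - _)%N => [|m] //.
  by move/eqP: E; rewrite subn_eq0 => le'; rewrite eqn_leq le' le_j in Nj.
exists [seq nth 0 (w1 ++ 0 :: w2) ((s^-1)%g j) | j <- l1].
exists [seq nth 0 (w1 ++ 0 :: w2) ((s^-1)%g j) | j <- l2] => z.
rewrite map_cat /= permK /= nth_cat ltnn subnn /=; congr (_ ++ _ :: _).
  apply/eq_in_map => j jl; apply: nth0; apply: Ni jl.
  by apply: contra Nl1 => ->.
by apply/eq_in_map => j jl; apply: nth0; apply: Ni jl.
Qed.

Lemma perm_word_mul n (s : 'S_n) a x y (w1 w2 : seq V) :
  n = (size w1 + (size w2).+1)%N ->
  word (perm_word s (w1 ++ (a *: x + y) :: w2)) =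
  a *: word (perm_word s (w1 ++ x :: w2)) + word (perm_word s (w1 ++ y :: w2)).
Proof.
by move=> /(perm_word_split s)[t1 [t2 E]]; rewrite !E word_multilinear.
Qed.

Lemma sh_sum_mull C v : multilinear_fun (fun u => sh_sum C u v).
Proof.
move=> a x y w1 w2; rewrite /sh_sum !size_cat /= scaler_sumr -big_split.
apply: eq_bigr => s _ /=; rewrite -!catA !cat_cons perm_word_mul //.
by rewrite size_cat -addnA.
Qed.

Lemma sh_sum_mulr C u : multilinear_fun (sh_sum C u).
Proof.
move=> a x y w1 w2; rewrite /sh_sum !size_cat /= scaler_sumr -big_split.
apply: eq_bigr => s _ /=; rewrite !catA perm_word_mul //.
by rewrite size_cat !addnA.
Qed.

Lemma shuffleE u v : shuffle (word u) (word v) = sh_word u v.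
Proof.
by apply: word_lift2_word => [w|w]; [exact: sh_sum_mull|exact: sh_sum_mulr].
Qed.

Lemma se_word_mull v : multilinear_fun (se_word^~ v).
Proof.
move=> a x y [|z w1] w2; case: v => [|b v] /=; rewrite ?scaler0 ?addr0 //.
- exact: (sh_sum_mull _ _ a x y [::]).
- exact: (sh_sum_mull _ _ a x y (z :: w1)).
Qed.

Lemma se_word_mulr u : multilinear_fun (se_word u).
Proof.
move=> a x y [|z w1] w2; case: u => [|b u] /=; rewrite ?scaler0 ?addr0 //.
- exact: (word_multilinear a x y [::]).
- exact: (sh_sum_mulr _ _ a x y [::]).
- exact: (word_multilinear a x y (z :: w1)).
- exact: (sh_sum_mulr _ _ a x y (z :: w1)).
Qed.

Lemma searrowE u v : searrow (word u) (word v) = se_word u v.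
Proof. exact: (word_lift2_word se_word_mull se_word_mulr). Qed.

Lemma ne_word_mull v : multilinear_fun (ne_word^~ v).
Proof.
move=> a x y [|z w1] w2; case: v => [|b v] /=; rewrite ?scaler0 ?addr0 //.
- exact: (sh_sum_mull _ _ a x y [::]).
- exact: (sh_sum_mull _ _ a x y (z :: w1)).
Qed.

Lemma ne_word_mulr u : multilinear_fun (ne_word u).
Proof.
move=> a x y [|z w1] w2; case: u => [|b u] /=; rewrite ?scaler0 ?addr0 //.
- exact: (sh_sum_mulr _ _ a x y [::]).
- exact: (sh_sum_mulr _ _ a x y (z :: w1)).
Qed.

Lemma nearrowE u v : nearrow (word u) (word v) = ne_word u v.
Proof. exact: (word_lift2_word ne_word_mull ne_word_mulr). Qed.

Lemma nw_word_mull v : multilinear_fun (nw_word^~ v).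
Proof.
move=> a x y [|z w1] w2; case: v => [|b v] /=; rewrite ?scaler0 ?addr0 //.
- exact: (word_multilinear a x y [::]).
- exact: (sh_sum_mull _ _ a x y [::]).
- exact: (word_multilinear a x y (z :: w1)).
- exact: (sh_sum_mull _ _ a x y (z :: w1)).
Qed.

Lemma nw_word_mulr u : multilinear_fun (nw_word u).
Proof.
move=> a x y [|z w1] w2; case: u => [|b u] /=; rewrite ?scaler0 ?addr0 //.
- exact: (sh_sum_mulr _ _ a x y [::]).
- exact: (sh_sum_mulr _ _ a x y (z :: w1)).
Qed.

Lemma nwarrowE u v : nwarrow (word u) (word v) = nw_word u v.
Proof. exact: (word_lift2_word nw_word_mull nw_word_mulr). Qed.

Lemma sw_word_mull v : multilinear_fun (sw_word^~ v).
Proof.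
move=> a x y [|z w1] w2; case: v => [|b v] /=; rewrite ?scaler0 ?addr0 //.
- exact: (sh_sum_mull _ _ a x y [::]).
- exact: (sh_sum_mull _ _ a x y (z :: w1)).
Qed.

Lemma sw_word_mulr u : multilinear_fun (sw_word u).
Proof.
move=> a x y [|z w1] w2; case: u => [|b u] /=; rewrite ?scaler0 ?addr0 //.
- exact: (sh_sum_mulr _ _ a x y [::]).
- exact: (sh_sum_mulr _ _ a x y (z :: w1)).
Qed.

Lemma swarrowE u v : swarrow (word u) (word v) = sw_word u v.
Proof. exact: (word_lift2_word sw_word_mull sw_word_mulr). Qed.

End TensorAlgebra.

(* Main.v *)
(* A shuffle of u with vw is a mask of bits, telling for each position whether
   its letter comes from u or from vw.  Cutting this mask just after the last
   letter of v splits the shuffle into a shuffle of a prefix of u with v ending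
   by a letter of v, and an arbitrary shuffle of the remaining suffix of u
   with w; cutting it just before the first letter of w gives the second
   formula.  Everything is multilinear, so words suffice. *)

Require Import Defs.
From HB Require Import structures.
From mathcomp Require Import all_boot fingroup perm all_algebra.

Set Implicit Arguments.
Unset Strict Implicit.
Unset Printing Implicit Defensive.

Import GRing.Theory.
Local Open Scope ring_scope.

(** * Masks and the two ways of cutting them *)

(* The masks with p bits true (letters of the first word) and q bits false. *)
Fixpoint masks (p : nat) : nat -> seq bitseq :=
  fix loop q := match p, q with
  | 0, _ => [:: nseq q false]
  | _, 0 => [:: nseq p true]
  | p'.+1, q'.+1 =>
      map (cons true) (masks p' q) ++ map (cons false) (loop q')
  end.

Lemma masksSS p q : masks p.+1 q.+1 =
  map (cons true) (masks p q.+1) ++ map (cons false) (masks p.+1 q).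
Proof. by []. Qed.

Lemma masks0n q : masks 0 q = [:: nseq q false]. Proof. by case: q. Qed.

Lemma masksn0 p : masks p 0 = [:: nseq p true]. Proof. by case: p. Qed.

(** The recursive enumeration misses no mask, and a mask drawn from it has known letter counts. *)
Lemma mem_masks p q m :
  (m \in masks p q) = (count_mem true m == p) && (count_mem false m == q).
Proof.
have nseqE b (s : bitseq) :
    (s == nseq (size s) b) = (count_mem (~~ b) s == 0%N).
  elim: s => //= c s; rewrite eqseq_cons => ->; by case: b; case: c.
have szE (s : bitseq) : size s = (count_mem true s + count_mem false s)%N.
  by elim: s => // -[] s /= ->; rewrite ?addnS.
elim: p q m => [|p IHp] q m.
  rewrite masks0n inE; apply/eqP/andP=> [->|[h0 /eqP <-]].
    by rewrite !count_nseq /= mul0n mul1n.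
  by apply/eqP; rewrite -[X in nseq X](add0n _) -(eqP h0) -szE nseqE.
elim: q m => [|q IHq] m.
  rewrite masksn0 inE; apply/eqP/andP=> [->|[/eqP <- h0]].
    by rewrite !count_nseq /= mul0n mul1n.
  by apply/eqP; rewrite -[X in nseq X](addn0 _) -(eqP h0) -szE nseqE.
rewrite masksSS mem_cat; case: m => [|b m].
  by apply/norP; split; apply/mapP => -[].
have cons_mem c l : (b :: m \in map (cons c) l) = (b == c) && (m \in l).
  apply/mapP/andP => [[m' m'l [-> ->]]|[/eqP -> ml]]; first by rewrite eqxx.
  by exists m.
by rewrite !cons_mem IHp IHq; case: b {cons_mem} => /=;
  rewrite ?orbF ?add0n ?add1n ?eqSS.
Qed.

Lemma masks_uniq p q : uniq (masks p q).
Proof.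
have injc (b : bool) : injective (cons b) by move=> m m' [].
elim: p q => [|p IHp] q; first by rewrite masks0n.
elim: q => [|q IHq]; first by rewrite masksn0.
rewrite masksSS cat_uniq !map_inj_uniq // IHp IHq andbT /=.
by apply/hasPn => _ /mapP[m _ ->]; apply/mapP => -[].
Qed.

Lemma last_nseq (T : Type) n (x : T) : last x (nseq n x) = x.
Proof. by elim: n. Qed.

(* The masks are cut just after the a-th [false]; the empty mask passes the test
   on m1, which is what is needed for a = 0. *)
Lemma sum_masks_last (W : nmodType) p a b (F : bitseq -> W) :
  \sum_(m <- masks p (a + b)) F m =
  \sum_(i < p.+1) \sum_(m1 <- masks i a | ~~ last false m1)
    \sum_(m2 <- masks (p - i) b) F (m1 ++ m2).
Proof.
elim: a p F => [|a IHa] p F.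
  (* For a = 0 only i = 0 survives: for i > 0 the sole mask of [masks i 0] ends in [true] and fails
     the test. *)
  rewrite big_ord_recl [X in _ + X]big1 => [|i _]; last first.
    by rewrite masksn0 big_cons big_nil /= last_nseq.
  by rewrite big_cons big_nil subn0 !addr0.
elim: p F => [|p IHp] F.
  rewrite big_ord1 !masks0n !big_cons !big_nil /= !addr0 last_nseq /=.
  by rewrite nseqD.
(* Splitting on the first bit: [true] lowers p, [false] lowers a. The summand i = 0 comes from
   [false] only. *)
rewrite addSn masksSS big_cat !big_map -addSn IHp IHa.
rewrite [RHS]big_ord_recl [X in _ + X = _]big_ord_recl addrCA; congr (_ + _).
  by rewrite !masks0n !big_cons !big_nil /= !last_nseq.
rewrite -big_split; apply: eq_bigr => i _.
rewrite lift0 masksSS big_cat !big_map; congr (_ + _).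
(* Prepending [true] changes the test for the empty mask only, which has too few [false] bits to be
   in the list. *)
rewrite big_seq_cond [RHS]big_seq_cond; apply: eq_big => [m|//].
rewrite mem_masks; case: m => [|c m] //=.
by rewrite !andbF.
Qed.

(* The masks are cut just before the (a+1)-st [false], at the end if b = 0. *)
Lemma sum_masks_head (W : nmodType) p a b (F : bitseq -> W) :
  \sum_(m <- masks p (a + b)) F m =
  \sum_(i < p.+1) \sum_(m1 <- masks i a)
    \sum_(m2 <- masks (p - i) b | ~~ head false m2) F (m1 ++ m2).
Proof.
elim: a p F => [|a IHa] p F.
  (* For a = 0 every m1 is a run of [true], so i is the length of the leading run, removed bit by
     bit by induction on p. *)
  elim: p F => [|p IHp] F.
    rewrite big_ord1 !masks0n !big_cons !big_nil /=.
    rewrite ?masks0n ?big_cons ?big_nil /=.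
    by rewrite !addr0; case: b.
  rewrite big_ord_recl masks0n big_cons big_nil addr0 subn0.
  rewrite (eq_bigr (fun i : 'I_p.+1 => \sum_(m1 <- masks i 0)
      \sum_(m2 <- masks (p - i) b | ~~ head false m2) F (true :: m1 ++ m2)));
    last by move=> i _; rewrite lift0 !masksn0 !big_cons !big_nil.
  rewrite -(IHp (F \o cons true)) add0n; case: b {IHp} => [|b].
    by rewrite !masksn0 !big_cons !big_nil /= !addr0 add0r.
  by rewrite masksSS !big_cat !big_map /= big_pred0_eq add0r addrC.
elim: p F => [|p IHp] F.
  rewrite !big_ord1 !masks0n !big_cons !big_nil /= !addr0.
  by have := IHa 0 (F \o cons false);
    rewrite !big_ord1 !masks0n !big_cons !big_nil /= !addr0.
rewrite addSn masksSS big_cat !big_map -addSn IHp IHa.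
rewrite [RHS]big_ord_recl [X in _ + X = _]big_ord_recl addrCA; congr (_ + _).
  by rewrite !masks0n !big_cons !big_nil.
rewrite -big_split; apply: eq_bigr => i _.
by rewrite lift0 masksSS big_cat !big_map.
Qed.

(** * Weaving two words along a mask *)

Section Weave.
Variable T : Type.
Implicit Types (m : bitseq) (u v t : seq T).

(** [take 1] supplies the next letter without a default value. In the intended use the lengths of u
    and v are the numbers of [true] and [false] bits. *)
Fixpoint weave m u v : seq T := match m with
  | [::] => [::]
  | true :: m' => take 1 u ++ weave m' (behead u) v
  | false :: m' => take 1 v ++ weave m' u (behead v)
  end.

(** The first block of the mask uses up exactly u1 and v1. This turns a cut of the mask into a
    concatenation product. *)
Lemma weave_cat m1 m2 u1 u2 v1 v2 :
    size u1 = count_mem true m1 -> size v1 = count_mem false m1 ->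
  weave (m1 ++ m2) (u1 ++ u2) (v1 ++ v2) = weave m1 u1 v1 ++ weave m2 u2 v2.
Proof.
elim: m1 u1 v1 => [|[] m1 IHm] [|x u1] [|y v1] //=;
  rewrite ?add0n ?add1n ?take0 //.
- by move=> [/(IHm u1 [::]) /[apply] ->].
- by move=> [/(IHm u1 (y :: v1)) /[apply] ->].
- by move=> /(IHm [::] v1) + [] => /[apply] ->.
- by move=> /(IHm (x :: u1) v1) + [] => /[apply] ->.
Qed.

Lemma weave_nseq_false v : weave (nseq (size v) false) [::] v = v.
Proof. by elim: v => //= y v ->; rewrite take0. Qed.

Lemma weave_mask m t :
  size m = size t -> weave m (mask m t) (mask (map negb m) t) = t.
Proof. by elim: m t => [|[] m IHm] [|x t] //= [/IHm ->]; rewrite take0. Qed.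

(** The last bit names the word that ends the weave; [weave_cat] detaches this bit together with the
    last letter of that word. *)
Lemma last_weave x m u v : size u = count_mem true m ->
  size v = count_mem false m -> (0 < size m)%N ->
  last x (weave m u v) = if last false m then last x u else last x v.
Proof.
case/lastP: m => // m b; rewrite last_rcons -cats1 !count_cat /= !addn0.
case: b => /=; rewrite ?addn0 ?addn1 => szu szv _.
- case/lastP: u szu => // u y; rewrite size_rcons => -[szu].
  by rewrite -cats1 -[v]cats0 weave_cat //= !last_cat ?cats0.
- case/lastP: v szv => // v y; rewrite size_rcons => -[szv].
  by rewrite -cats1 -[u]cats0 weave_cat //= !last_cat ?cats0.
Qed.

End Weave.

Lemma map_weave (T S : Type) (f : T -> S) m u v :
  map f (weave m u v) = weave m (map f u) (map f v).
Proof.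
elim: m u v => [|[] m IHm] u v //=; rewrite map_cat IHm map_take.
  by rewrite behead_map.
by rewrite behead_map.
Qed.

(** * The bijection between shuffle permutations and masks *)

Section ShuffleCode.
Variables p q : nat.
Local Notation n := (p + q)%N.
Local Notation I := (enum 'I_n).
Local Notation lsh := [seq lshift q i | i <- enum 'I_p].
Local Notation rsh := [seq rshift p i | i <- enum 'I_q].
Local Notation ltI := (relpre val ltn : rel 'I_n).

(* The letter in position i of the shuffle comes from the first word exactly
   when the bit i is set. *)
Definition shuffle_code (s : 'S_n) : bitseq :=
  [seq ((s^-1)%g i < p)%N | i <- I].

Lemma sorted_enum_ord k : sorted (relpre val ltn) (enum 'I_k).
Proof. by rewrite -sorted_map val_enum_ord iota_ltn_sorted. Qed.

Lemma ltI_trans : transitive ltI.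
Proof. by move=> j i k; apply: ltn_trans. Qed.

Lemma ltI_irr : irreflexive ltI.
Proof. by move=> i; rewrite /= ltnn. Qed.

(** Sortedness of the two image lists is the usable form, since a strictly increasing list is
    determined by its members. *)
Lemma is_shuffleP (s : 'S_n) :
  reflect (sorted ltI (map s lsh) /\ sorted ltI (map s rsh)) (is_shuffle s).
Proof.
have mono k (f : 'I_k -> 'I_n) :
    reflect (sorted ltI (map f (enum 'I_k)))
      [forall i : 'I_k, forall j : 'I_k, (i < j) ==> (f i < f j)]%N.
  apply: (iffP forallP) => [h|sf i].
    apply: homo_sorted (sorted_enum_ord k) => i j.
    by move: (h i) => /forallP/(_ j)/implyP.
  apply/forallP => j; apply/implyP => lt_ij.
  have /(_ (f i) i j) := sorted_ltn_nth ltI_trans _ sf.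
  have szf : size (map f (enum 'I_k)) = k by rewrite size_map size_enum_ord.
  have nthf l : nth (f i) (map f (enum 'I_k)) (l : 'I_k) = f l.
    by rewrite (nth_map l) ?size_enum_ord // nth_ord_enum.
  by rewrite !inE szf !ltn_ord !nthf; apply.
rewrite -(map_comp s (@lshift p q)) -(map_comp s (@rshift p q)).
apply: (iffP andP) => -[hl hr]; split.
- exact: (elimT (mono _ (s \o @lshift p q)) hl).
- exact: (elimT (mono _ (s \o @rshift p q)) hr).
- exact: (introT (mono _ (s \o @lshift p q)) hl).
- exact: (introT (mono _ (s \o @rshift p q)) hr).
Qed.

(** Both sides are strictly increasing lists of the positions that [s^-1] sends below p. *)
Lemma map_lsh_mask (s : 'S_n) : is_shuffle s ->
  map s lsh = mask (shuffle_code s) I.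
Proof.
case/is_shuffleP => hl _; rewrite /shuffle_code -filter_mask.
apply: (irr_sorted_eq ltI_trans ltI_irr) => //.
  by apply: sorted_filter (sorted_enum_ord n); exact: ltI_trans.
move=> x; rewrite mem_filter mem_enum andbT.
apply/mapP/idP => [[_ /mapP[i _ ->] ->]|lt_xp].
  by rewrite permK /= ltn_ord.
exists ((s^-1)%g x); last by rewrite permKV.
by apply/mapP; exists (Ordinal lt_xp); [rewrite mem_enum|apply: val_inj].
Qed.

Lemma map_rsh_mask (s : 'S_n) : is_shuffle s ->
  map s rsh = mask (map negb (shuffle_code s)) I.
Proof.
case/is_shuffleP => _ hr; rewrite /shuffle_code.
rewrite -[map negb _]map_comp -filter_mask.
apply: (irr_sorted_eq ltI_trans ltI_irr) => //.
  by apply: sorted_filter (sorted_enum_ord n); exact: ltI_trans.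
move=> x; rewrite mem_filter mem_enum andbT /=.
apply/mapP/idP => [[_ /mapP[i _ ->] ->]|].
  by rewrite permK /= -leqNgt leq_addr.
case: (split_ordP ((s^-1)%g x)) => i E; rewrite /= ?ltn_ord // => _.
exists (rshift p i); last by rewrite -E permKV.
by apply/mapP; exists i; rewrite ?mem_enum.
Qed.

Lemma size_shuffle_code s : size (shuffle_code s) = n.
Proof. by rewrite size_map size_enum_ord. Qed.

(** The list of all positions is the weave of its selections by the code and by the complement,
    which are the images of the two blocks under [s]; [s^-1] then undoes [s]. *)
Lemma map_shuffle (T : Type) (f : 'I_n -> T) (s : 'S_n) : is_shuffle s ->
  [seq f ((s^-1)%g i) | i <- I] =
    weave (shuffle_code s) (map f lsh) (map f rsh).
Proof.
move=> sh_s; rewrite -[in LHS](@weave_mask _ (shuffle_code s) I); last first.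
  by rewrite size_shuffle_code size_enum_ord.
rewrite -map_lsh_mask // -map_rsh_mask // map_weave.
congr weave; rewrite -[LHS]map_comp;
  by apply: eq_map => i /=; rewrite permK.
Qed.

(** The code determines the image lists of both blocks, hence [s] at every point. *)
Lemma shuffle_code_inj : {in @is_shuffle p q &, injective shuffle_code}.
Proof.
move=> s s' sh_s sh_s' E; apply/permP => x.
have /eq_in_map El : map s lsh = map s' lsh by rewrite !map_lsh_mask ?E.
have /eq_in_map Er : map s rsh = map s' rsh by rewrite !map_rsh_mask ?E.
by case: (split_ordP x) => i ->; [apply: El|apply: Er]; rewrite map_f ?mem_enum.
Qed.

Lemma shuffle_code_masks s : is_shuffle s -> shuffle_code s \in masks p q.
Proof.
move=> sh_s; have sz := size_shuffle_code s; rewrite mem_masks.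
have szE k (f : 'I_k -> 'I_n) : size (map s (map f (enum 'I_k))) = k.
  by rewrite (size_map s) (size_map f) size_enum_ord.
have := szE _ (@lshift p q); have := szE _ (@rshift p q).
rewrite map_lsh_mask // map_rsh_mask //.
rewrite !size_mask ?(size_map negb) ?sz ?size_enum_ord //.
move=> Er El; rewrite -[X in _ == X]El -[X in _ && (_ == X)]Er count_map.
by apply/andP; split; apply/eqP; apply: eq_count => -[].
Qed.

(** Serves to read off the code of the permutation built from a mask. *)
Lemma map_mem_mask (T : eqType) (m : bitseq) (t : seq T) :
  uniq t -> size m = size t -> [seq x \in mask m t | x <- t] = m.
Proof.
elim: m t => [|b m IHm] [|x t] //= /andP[xt ut] [szm].
rewrite -[in RHS](IHm t) //; congr (_ :: _).
  by case: b => /=; rewrite ?mem_head //; apply: contraNF xt => /mem_mask.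
apply/eq_in_map => y yt; case: b; rewrite //= inE.
by case: eqP => // yx; rewrite -yx yt in xt.
Qed.

Lemma shuffle_code_onto m : m \in masks p q ->
  exists2 s : 'S_n, is_shuffle s & shuffle_code s = m.
Proof.
rewrite mem_masks => /andP[/eqP cl /eqP cr].
have szm : size m = size I.
  rewrite size_enum_ord -cl -cr -(count_predC (pred1 true)); congr addn.
  by apply: eq_count => -[].
have szl : size (mask m I) = p.
  by rewrite size_mask // -[RHS]cl; apply: eq_count => -[].
have szr : size (mask (map negb m) I) = q.
  by rewrite size_mask ?(size_map negb) // count_map -[RHS]cr;
    apply: eq_count => -[].
(* The permutation lists the positions of the [true] bits, then those of the [false] bits, each in
   increasing order. *)
pose e := mask m I ++ mask (map negb m) I.
have sze : size e = n by rewrite size_cat szl szr.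
have ue : uniq e.
  rewrite cat_uniq !mask_uniq ?enum_uniq // andbT /=.
  (* Complementary masks select disjoint parts of a duplicate-free list. *)
  have := enum_uniq 'I_n; move: (I) szm.
  elim: (m) => [|b m' IHm] [|x t] //= [szt] /andP[xt ut].
  have {IHm}/hasPn h := IHm t szt ut; apply/hasPn.
  case: b => /= y; rewrite ?inE => yt.
    apply/negP => /predU1P[yx|]; last exact/negP/h.
    by rewrite -yx (mem_mask yt) in xt.
  case/predU1P: yt => [->|/h //].
  by apply: contraNN xt => /mem_mask.
(* The default j is never reached, since [e] has length n. *)
have f_inj : injective (fun j : 'I_n => nth j e j).
  move=> i j; rewrite (set_nth_default j) ?sze // => /eqP.
  by rewrite nth_uniq ?sze // => /eqP/val_inj.
pose s := perm f_inj.
have sE x : s x = nth x e x by rewrite permE.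
have sl i : s (lshift q i) = nth (lshift q i) (mask m I) i.
  by rewrite sE nth_cat szl /= ltn_ord.
have sr i : s (rshift p i) = nth (rshift p i) (mask (map negb m) I) i.
  by rewrite sE nth_cat szl /= ltnNge leq_addr addKn.
have sorted_m m' : sorted ltI (mask m' I).
  by apply: sorted_mask (sorted_enum_ord n); exact: ltI_trans.
exists s.
  apply/andP; split; apply/forallP => i; apply/forallP => j; apply/implyP => ij.
    rewrite !sl (set_nth_default (lshift q i) (lshift q j)) ?szl //.
    by apply: (sorted_ltn_nth ltI_trans) => //; rewrite inE szl.
  rewrite !sr (set_nth_default (rshift p i) (rshift p j)) ?szr //.
  by apply: (sorted_ltn_nth ltI_trans) => //; rewrite inE szr.
rewrite -[RHS](map_mem_mask (enum_uniq 'I_n) szm); apply: eq_map => i.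
rewrite -{2}[i](permKV s); case: (split_ordP ((s^-1)%g i)) => j ->.
  by rewrite sl mem_nth ?szl ?ltn_ord.
(* The second block lands outside [mask m I] because [e] has no repetition. *)
move: ue; rewrite cat_uniq => /and3P[_ /hasPn h _].
rewrite sr; apply/esym/negbTE/h.
by rewrite mem_nth ?szr.
Qed.

(** Reindexing along the bijection [shuffle_code]; P will carry the conditions on the first and last
    letters. *)
Lemma sum_shuffles (W : nmodType) (P : pred bitseq) (F : bitseq -> W) :
  \sum_(s : 'S_n | is_shuffle s && P (shuffle_code s)) F (shuffle_code s) =
  \sum_(m <- masks p q | P m) F m.
Proof.
rewrite -big_enum_cond /= -(big_map shuffle_code P F).
apply: perm_big; apply: uniq_perm; rewrite ?masks_uniq //.
  rewrite map_inj_in_uniq ?enum_uniq // => s s'.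
  by rewrite !mem_enum; exact: shuffle_code_inj.
move=> m; apply/mapP/idP => [[s] | /shuffle_code_onto[s sh_s <-]].
  by rewrite mem_enum => /shuffle_code_masks ? ->.
by exists s; rewrite ?mem_enum.
Qed.

End ShuffleCode.


(** * First and last letters of a shuffle of nonempty words *)

Section BoundaryLetters.
Variables (p q : nat) (s : 'S_(p.+1 + q.+1)).
Hypothesis sh_s : is_shuffle s.
Local Notation code := (shuffle_code s).

Lemma count_shuffle_code :
  count_mem true code = p.+1 /\ count_mem false code = q.+1.
Proof.
by have := shuffle_code_masks sh_s; rewrite mem_masks => /andP[/eqP ? /eqP].
Qed.

(** Weaving the letter numbers themselves makes the origin of each letter visible. *)
Lemma shuffle_letters :
  [seq val ((s^-1)%g i) | i <- enum 'I_(p.+1 + q.+1)] =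
    weave code (iota 0 p.+1) (iota p.+1 q.+1).
Proof.
rewrite map_shuffle // -[iota 0 _]val_enum_ord -[in iota p.+1 _](addn0 p.+1).
rewrite iotaDl -val_enum_ord.
by rewrite -[X in weave _ X]map_comp -[X in weave _ _ X]map_comp
  -[X in _ = weave _ _ X]map_comp.
Qed.

Lemma inv_atE i j (lt_i : (i < p.+1 + q.+1)%N) : inv_at s i j =
  (nth 0 [seq val ((s^-1)%g x) | x <- enum 'I_(p.+1 + q.+1)] i == j).
Proof.
have -> : nth 0 [seq val ((s^-1)%g x) | x <- enum 'I_(p.+1 + q.+1)] i =
    val ((s^-1)%g (Ordinal lt_i)).
  rewrite (nth_map (Ordinal lt_i)) ?size_enum_ord //.
  by rewrite -[i in nth _ _ i]/(nat_of_ord (Ordinal lt_i)) nth_ord_enum.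
apply/existsP/idP => [[x /andP[/eqP xi]]|h].
  by have -> : x = Ordinal lt_i by apply: val_inj.
by exists (Ordinal lt_i); rewrite eqxx.
Qed.

(** Order is kept inside each block, so a shuffle begins with letter 0 or p+1, as the first bit
    decides. *)
Lemma shuffle_first j :
  inv_at s 0 j = ((if head false code then 0 else p.+1) == j).
Proof.
rewrite inv_atE // shuffle_letters.
by move: (size_shuffle_code s); case: (code) => // -[].
Qed.

(** Likewise the final letter is the last one of its block, p or p+q+1. *)
Lemma shuffle_last j : inv_at s (p.+1 + q.+1).-1 j =
  ((if last false code then p else (p.+1 + q.+1).-1) == j).
Proof.
have [cl cr] := count_shuffle_code.
have -> := @inv_atE (p.+1 + q.+1).-1 j; last by rewrite addSn ltnS leqnn.
set t := map _ _; have szt : size t = (p.+1 + q.+1)%N.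
  by rewrite (size_map (fun i => val ((s^-1)%g i))) size_enum_ord.
rewrite -szt nth_last szt /t shuffle_letters last_weave ?size_iota //;
  last by rewrite size_shuffle_code.
by rewrite -!nth_last !size_iota !nth_iota // add0n [in RHS]addnS.
Qed.

Lemma shuffle_first_l : inv_at s 0 0 = head false code.
Proof. by rewrite shuffle_first; case: head. Qed.

Lemma shuffle_first_r : inv_at s 0 p.+1 = ~~ head false code.
Proof. by rewrite shuffle_first; case: head; rewrite //= eqxx. Qed.

Lemma shuffle_last_l : inv_at s (p.+1 + q.+1).-1 p = last false code.
Proof.
rewrite shuffle_last; case: last; rewrite ?eqxx //.
by rewrite addSn /= -[X in _ == X]addn0 eqn_add2l.
Qed.

Lemma shuffle_last_r :
  inv_at s (p.+1 + q.+1).-1 (p.+1 + q.+1).-1 = ~~ last false code.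
Proof.
rewrite shuffle_last; case: last; rewrite ?eqxx //.
by rewrite addSn /= -[X in X == _]addn0 eqn_add2l.
Qed.

End BoundaryLetters.

(** * The products of words as sums over masks *)

Section Words.
Variables (k : fieldType) (V : lmodType k).
Implicit Types u v w : seq V.

(** Common form of the shuffle product and of the derived operations: only the test P varies. *)
Definition mask_sum (P : pred bitseq) u v : tensalg V :=
  \sum_(m <- masks (size u) (size v) | P m) word (weave m u v).

Lemma perm_word_weave p q (s : 'S_(p + q)) u v : is_shuffle s ->
  size u = p -> size v = q -> perm_word s (u ++ v) = weave (shuffle_code s) u v.
Proof.
move=> sh_s szu szv; subst p q.
rewrite /perm_word (map_shuffle (fun i => nth 0 (u ++ v) i)) //.
congr weave; rewrite -[LHS]map_comp.
  rewrite -[RHS](mkseq_nth 0) /mkseq -val_enum_ord -[RHS]map_comp.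
  by apply: eq_map => i /=; rewrite nth_cat ltn_ord.
rewrite -[RHS](mkseq_nth 0) /mkseq -val_enum_ord -[RHS]map_comp.
by apply: eq_map => i /=; rewrite nth_cat ltnNge leq_addr addKn.
Qed.

Lemma sh_sum_masks (C : forall p q, pred 'S_(p + q)) (P : pred bitseq) u v :
    (forall s, is_shuffle s -> C (size u) (size v) s = P (shuffle_code s)) ->
  sh_sum C u v = mask_sum P u v.
Proof.
move=> CP; rewrite /mask_sum -sum_shuffles /sh_sum.
apply: eq_big => [s|s /andP[sh_s _]]; last by rewrite perm_word_weave.
by case: (boolP (is_shuffle s)) => //= /CP ->.
Qed.

Lemma sh_wordE u v : sh_word u v = mask_sum predT u v.
Proof. exact: sh_sum_masks. Qed.

Lemma mask_sum_nil (P : pred bitseq) v : P (nseq (size v) false) ->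
  mask_sum P [::] v = word v.
Proof.
move=> Pv; rewrite /mask_sum masks0n big_cons big_nil Pv.
by rewrite weave_nseq_false addr0.
Qed.

Lemma mask_sumID (Q P P1 P2 : pred bitseq) u v :
    (forall m, P m && Q m = P1 m) -> (forall m, P m && ~~ Q m = P2 m) ->
  mask_sum P1 u v + mask_sum P2 u v = mask_sum P u v.
Proof.
move=> E1 E2; rewrite /mask_sum [RHS](bigID Q) /=.
by congr (_ + _); apply: eq_bigl => m; rewrite -?E1 -?E2.
Qed.

(** The two operations share the condition on the last letter and split on the origin of the first,
    which their sum forgets. *)
Lemma vee_wordE u v : (0 < size v)%N ->
  se_word u v + sw_word u v = mask_sum (fun m => ~~ last false m) u v.
Proof.
case: v => // y v _; case: u => [|x u].
  (* For u empty, the convention that [se_word] returns v matches the single all-[false] mask, which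
     passes the test. *)
  by rewrite addr0 mask_sum_nil //= last_nseq.
rewrite /= (@sh_sum_masks _ (fun m => ~~ head false m && ~~ last false m)).
  rewrite (@sh_sum_masks _ (fun m => head false m && ~~ last false m)).
    by rewrite addrC; apply: (mask_sumID (Q := head false)) => m; exact: andbC.
  by move=> s sh_s;
    exact: (congr2 andb (shuffle_first_l sh_s) (shuffle_last_r sh_s)).
by move=> s sh_s;
  exact: (congr2 andb (shuffle_first_r sh_s) (shuffle_last_r sh_s)).
Qed.

(** Here the first letter is prescribed and the origin of the last one is forgotten. *)
Lemma succ_wordE u v : (0 < size v)%N ->
  ne_word u v + se_word u v = mask_sum (fun m => ~~ head false m) u v.
Proof.
case: v => // y v _; case: u => [|x u].
  by rewrite add0r mask_sum_nil.
rewrite /= (@sh_sum_masks _ (fun m => ~~ head false m && last false m)).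
  rewrite (@sh_sum_masks _ (fun m => ~~ head false m && ~~ last false m)).
    exact: (mask_sumID (Q := last false)).
  by move=> s sh_s;
    exact: (congr2 andb (shuffle_first_r sh_s) (shuffle_last_r sh_s)).
by move=> s sh_s;
  exact: (congr2 andb (shuffle_first_r sh_s) (shuffle_last_l sh_s)).
Qed.

(** * Concatenation of mask sums and the two formulas on words *)

Lemma conc_bilinear : bilinear_fun (@conc k V).
Proof. exact: word_lift2_bilinear (@conc_mull k V) (@conc_mulr k V). Qed.

Lemma linear_sum_fun (U W : lmodType k) (f : U -> W) (I : Type) (r : seq I)
    (P : pred I) (F : I -> U) : linear f ->
  f (\sum_(i <- r | P i) F i) = \sum_(i <- r | P i) f (F i).
Proof.
move=> fl; pose L := GRing.isLinear.Build _ _ _ _ _ fl.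
pose g : {linear _ -> _} := HB.pack f L.
exact: (linear_sum g).
Qed.

Lemma conc_mask_sum (P1 P2 : pred bitseq) u1 v1 u2 v2 :
  conc (mask_sum P1 u1 v1) (mask_sum P2 u2 v2) =
  \sum_(m1 <- masks (size u1) (size v1) | P1 m1)
    \sum_(m2 <- masks (size u2) (size v2) | P2 m2)
      word (weave (m1 ++ m2) (u1 ++ u2) (v1 ++ v2)).
Proof.
have [cl cr] := conc_bilinear.
rewrite /mask_sum (linear_sum_fun _ _ _ (cl _)) big_seq_cond [RHS]big_seq_cond.
(* Membership of m1 in the list gives the letter counts required by [weave_cat]. *)
apply: eq_bigr => m1; rewrite mem_masks => /andP[/andP[/eqP c1 /eqP c2] _].
rewrite (linear_sum_fun _ _ _ (cr _)); apply: eq_bigr => m2 _.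
by rewrite concE weave_cat.
Qed.

(** Here i counts the letters of u before the cut; the test on the last bit places the cut just
    after v ends. *)
Lemma sh_word_cat_last u v w :
  sh_word u (v ++ w) = \sum_(i < (size u).+1)
    conc (mask_sum (fun m => ~~ last false m) (take i u) v)
         (sh_word (drop i u) w).
Proof.
rewrite sh_wordE /mask_sum size_cat sum_masks_last; apply: eq_bigr => i _.
rewrite sh_wordE conc_mask_sum cat_take_drop size_drop size_takel //.
by rewrite -ltnS.
Qed.

(** Now the test on the first bit of the second part places the cut just before w begins. *)
Lemma sh_word_cat_head u v w :
  sh_word u (v ++ w) = \sum_(i < (size u).+1)
    conc (sh_word (take i u) v)
         (mask_sum (fun m => ~~ head false m) (drop i u) w).
Proof.
rewrite sh_wordE /mask_sum size_cat sum_masks_head; apply: eq_bigr => i _.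
rewrite sh_wordE conc_mask_sum cat_take_drop size_drop size_takel //.
by rewrite -ltnS.
Qed.

(** * Extension from words to tensors by linearity *)

Lemma linear_comp_fun (U1 U2 W : lmodType k) (f : U2 -> W) (g : U1 -> U2) :
  linear f -> linear g -> linear (fun x => f (g x)).
Proof. by move=> fl gl a x y; rewrite gl fl. Qed.

Lemma linear_sum_funs (U W : lmodType k) (I : Type) (r : seq I)
    (F : I -> U -> W) :
  (forall i, linear (F i)) -> linear (fun x => \sum_(i <- r) F i x).
Proof.
move=> Fl a x y; rewrite scaler_sumr -big_split.
by apply: eq_bigr => i _; rewrite Fl.
Qed.

(** Applied once per argument, with all words as generators for the first and the nonempty words for
    the other two. *)
Lemma eq_lspan (U W : lmodType k) (P : U -> Prop) (f g : U -> W) x :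
    linear f -> linear g -> (forall y, P y -> f y = g y) ->
  lspan P x -> f x = g x.
Proof.
move=> fl gl fg [r rP ->]; rewrite !linear_sum_fun // !big_seq.
apply: eq_bigr => -[a y] /rP/fg E /=.
have lZ (h : U -> W) : linear h -> h (a *: y) = a *: h y.
  (* Linearity is a single identity in a, x, y; taking a = -1 and x = y = 0 gives the value at 0. *)
  move=> hl; have h0 : h 0 = 0.
    by have := hl (-1) 0 0; rewrite !scaleN1r oppr0 addr0 addNr.
  by rewrite -[a *: y]addr0 hl h0 addr0.
by rewrite !lZ // E.
Qed.

Lemma bilinear_addf (U1 U2 W : lmodType k) (A B : U1 -> U2 -> W) :
  bilinear_fun A -> bilinear_fun B -> bilinear_fun (fun x y => A x y + B x y).
Proof.
move=> [Al Ar] [Bl Br]; split=> [y a x x'|x a y y'];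
  by rewrite scalerDr addrACA ?Al ?Bl ?Ar ?Br.
Qed.

Lemma shuffle_bilinear : bilinear_fun (@shuffle k V).
Proof.
by apply: word_lift2_bilinear => w; [exact: sh_sum_mull|exact: sh_sum_mulr].
Qed.

Lemma qvee_bilinear : bilinear_fun (@qvee k V).
Proof.
apply: bilinear_addf.
  exact: word_lift2_bilinear (@se_word_mull k V) (@se_word_mulr k V).
exact: word_lift2_bilinear (@sw_word_mull k V) (@sw_word_mulr k V).
Qed.

Lemma qsucc_bilinear : bilinear_fun (@qsucc k V).
Proof.
apply: bilinear_addf.
  exact: word_lift2_bilinear (@ne_word_mull k V) (@ne_word_mulr k V).
exact: word_lift2_bilinear (@se_word_mull k V) (@se_word_mulr k V).
Qed.

Lemma deconc_sum_linear (W : lmodType k) (B : tensalg V -> tensalg V -> W) :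
  bilinear_fun B -> linear (deconc_sum B).
Proof.
move=> Bbil; apply: linear_comp_fun; first exact: tensor_liftP.
exact: word_liftP (@deconc_multilinear k V).
Qed.

(** Treats both formulas at once: (A, B) will be ([qvee], [shuffle]), then ([shuffle], [qsucc]). *)
Lemma shuffle_conc_of_words (A B : tensalg V -> tensalg V -> tensalg V) :
    bilinear_fun A -> bilinear_fun B ->
    (forall u v w, (0 < size v)%N -> (0 < size w)%N ->
       sh_word u (v ++ w) = \sum_(i < (size u).+1)
         conc (A (word (take i u)) (word v)) (B (word (drop i u)) (word w))) ->
  forall x y z, tensalg_plus y -> tensalg_plus z ->
  shuffle x (conc y z) = deconc_sum (fun x1 x2 => conc (A x1 y) (B x2 z)) x.
Proof.
move=> [Al Ar] [Bl Br] AB x y z y_plus z_plus.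
have [cl cr] := conc_bilinear; have [sl sr] := shuffle_bilinear.
have ABbil : bilinear_fun (fun x1 x2 => conc (A x1 y) (B x2 z)).
  split=> [x2|x1]; first exact: linear_comp_fun (cl _) (Al y).
  exact: linear_comp_fun (cr _) (Bl z).
apply: (eq_lspan (sl _) (deconc_sum_linear ABbil) _ (tensalg_span x)).
move=> _ [u ->]; rewrite deconc_sumE //.
(* Once u is a word the deconcatenation is an explicit sum, linear in y and in z separately. *)
pose S y z := \sum_(i < (size u).+1)
  conc (A (word (take i u)) y) (B (word (drop i u)) z).
rewrite -/(S y z).
apply: (eq_lspan (f := fun y => shuffle (word u) (conc y z)) (g := S^~ z)
  _ _ _ y_plus).
- exact: linear_comp_fun (sr _) (cl z).
- by apply: linear_sum_funs => i; apply: linear_comp_fun (cl _) (Ar _).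
move=> _ [v v_gt0 ->].
apply: (eq_lspan (f := fun z => shuffle (word u) (conc (word v) z))
  (g := S (word v)) _ _ _ z_plus).
- exact: linear_comp_fun (sr _) (cr _).
- by apply: linear_sum_funs => i; apply: linear_comp_fun (cr _) (Br _).
by move=> _ [w w_gt0 ->]; rewrite concE shuffleE AB.
Qed.

End Words.

Theorem corollary2 (k : fieldType) (V : lmodType k) (u v w : tensalg V)
    (hv : tensalg_plus v) (hw : tensalg_plus w) :
  shuffle u (conc v w) =
    deconc_sum (fun u1 u2 => conc (qvee u1 v) (shuffle u2 w)) u /\
  deconc_sum (fun u1 u2 => conc (qvee u1 v) (shuffle u2 w)) u =
    deconc_sum (fun u1 u2 => conc (shuffle u1 v) (qsucc u2 w)) u.
Proof.
have vee_eq : shuffle u (conc v w) =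
    deconc_sum (fun u1 u2 => conc (qvee u1 v) (shuffle u2 w)) u.
  apply: shuffle_conc_of_words hv hw => [||s t r t_gt0 r_gt0].
  - exact: qvee_bilinear.
  - exact: shuffle_bilinear.
  rewrite sh_word_cat_last; apply: eq_bigr => i _.
  by rewrite shuffleE /qvee searrowE swarrowE vee_wordE.
(* The two deconcatenation sums are compared through the shuffle product, not directly. *)
split; [exact: vee_eq | rewrite -vee_eq].
apply: shuffle_conc_of_words hv hw => [||s t r t_gt0 r_gt0].
- exact: shuffle_bilinear.
- exact: qsucc_bilinear.
rewrite sh_word_cat_head; apply: eq_bigr => i _.
by rewrite shuffleE /qsucc nearrowE searrowE succ_wordE.
Qed.
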